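(* Let $\Omega\subseteq\mathbb{R}^n$ be open and bounded, let $f\in\mathcal{F}_2(\mathbb{R}^m)$ be non-negative and strictly convex, and let $M\subseteq\mathbf{Y}$ be a convex set of generalized Young measures, i.e. for all $\tau\in[0,1]$ the convex combination of any two elements of $M$ lies in $M$. Let $(\nu^1,\lambda^1,(\nu^\infty)^1),(\nu^2,\lambda^2,(\nu^\infty)^2)\in M$ be two generalized Young measures which are both maximal, i.e. for $i=1,2$ $$\mathcal{V}_f[\nu^i,\lambda^i,(\nu^\infty)^i]=\max_{(\widetilde\nu,\widetilde\lambda,\widetilde\nu^\infty)\in M}\mathcal{V}_f[\widetilde\nu,\widetilde\lambda,\widetilde\nu^\infty].$$ Then $$\langle\nu^1_x,\cdot\rangle=\langle\nu^2_x,\cdot\rangle\quad\text{for a.e. }x\in\Omega,$$ and $$\int_\Omega\langle\nu^1_x,f\rangle\,dx+\int_{\overline\Omega}\langle(\nu^\infty)^1_x,f^\infty\rangle\,d\lambda^1(x)=\int_\Omega\langle\nu^2_x,f\rangle\,dx+\int_{\overline\Omega}\langle(\nu^\infty)^2_x,f^\infty\rangle\,d\lambda^2(x).$$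
   Context: Let $n,m\in\mathbb{N}$ and $\Omega\subseteq\mathbb{R}^n$ open and bounded. $\mathcal{M}(X)$, $\mathcal{M}^+(X)$, $\mathcal{P}(X)$ denote the finite, the non-negative finite, and the probability Radon measures on $X$; $\mathcal{S}^{m-1}$ is the unit sphere in $\mathbb{R}^m$. For a measure $\mu$ on a set $D$, $L^\infty_{\rm weak}(D,\mu;\mathcal{P}(X))$ is the space of maps $\nu:D\to\mathcal{P}(X)$ such that $x\mapsto\langle\nu_x,g\rangle:=\int_X g(z)\,d\nu_x(z)$ is $\mu$-measurable for every bounded Borel $g:X\to\mathbb{R}$ ($\mu$ is omitted if it is Lebesgue measure). $\langle\nu_x,\cdot\rangle:=\int z\,d\nu_x(z)\in\mathbb{R}^m$ is the barycenter. A generalized Young measure is a triple $(\nu,\lambda,\nu^\infty)$ with $\nu\in L^\infty_{\rm weak}(\Omega;\mathcal{P}(\mathbb{R}^m))$, $\lambda\in\mathcal{M}^+(\overline\Omega)$, $\nu^\infty\in L^\infty_{\rm weak}(\overline\Omega,\lambda;\mathcal{P}(\mathcal{S}^{m-1}))$ satisfying $\int_\Omega\langle\nu_x,|\cdot|^2\rangle\,dx+\lambda(\overline\Omega)<\infty$. The set of all generalized Young measures is $\mathbf{Y}$. $\mathcal{A}(\mathbb{R}^m)$ is the set of bounded continuous $f_0:\mathbb{R}^m\to\mathbb{R}$ such that $\lim_{s\to\infty}f_0(sz)$ exists and is continuous in $z\in\mathcal{S}^{m-1}$. $\mathcal{F}_2(\mathbb{R}^m)$ is the set of $f\in C(\mathbb{R}^m)$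 of the form $f=(1+|\cdot|^2)f_0$ with $f_0\in\mathcal{A}(\mathbb{R}^m)$. The recession function is $f^\infty:\mathcal{S}^{m-1}\to\mathbb{R}$, $f^\infty(z)=\lim_{s\to\infty}\frac{f(sz)}{1+s^2}$. For $\tau\in[0,1]$, the convex combination $(\widehat\nu,\widehat\lambda,\widehat\nu^\infty)\in\mathbf{Y}$ of $(\nu^1,\lambda^1,(\nu^\infty)^1),(\nu^2,\lambda^2,(\nu^\infty)^2)\in\mathbf{Y}$ is given by the identity of measures on $\overline\Omega$ $$\langle\widehat\nu_x,g\rangle dx+\langle\widehat\nu^\infty_x,g^\infty\rangle\widehat\lambda=\tau\big(\langle\nu^1_x,g\rangle dx+\langle(\nu^\infty)^1_x,g^\infty\rangle\lambda^1\big)+(1-\tau)\big(\langle\nu^2_x,g\rangle dx+\langle(\nu^\infty)^2_x,g^\infty\rangle\lambda^2\big)$$ for all $g\in\mathcal{F}_2(\mathbb{R}^m)$. For convex non-negative $f\in\mathcal{F}_2(\mathbb{R}^m)$, $$\mathcal{V}_f[\nu,\lambda,\nu^\infty]=\int_\Omega\big[\langle\nu_x,f\rangle-f(\langle\nu_x,\cdot\rangle)\big]dx+\int_{\overline\Omega}\langle\nu^\infty_x,f^\infty\rangle\,d\lambda(x).$$ *)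

(* Defs.v *)
From HB Require Import structures.
From mathcomp Require Import all_boot all_order all_algebra.
From mathcomp Require Import all_classical all_reals all_analysis.
From mathcomp Require Import measurable_realfun.

Set Implicit Arguments.
Unset Strict Implicit.
Unset Printing Implicit Defensive.

Import Order.TTheory GRing.Theory Num.Theory.
Import numFieldNormedType.Exports.

Local Open Scope classical_set_scope.
Local Open Scope ring_scope.

(* The Borel sigma-algebra on matrices, in particular on R^n = 'rV[R]_n. *)
HB.instance Definition _ (R : realType) (m n : nat) :=
  @isMeasurable.Build (sigma_display (@open 'M[R]_(m, n))) 'M[R]_(m, n)
    <<s @open 'M[R]_(m, n) >> (@sigma_algebra0 _ setT _) (@sigma_algebraC _ _)
    (@sigma_algebra_bigcup _ setT _).

Section image_measure.
Context d d' (T : measurableType d) (T' : measurableType d') (R : realType).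
Variables (mu : {measure set T -> \bar R}) (f : {mfun T >-> T'}).

Definition image_measure : set T' -> \bar R := pushforward mu f.

Let image_measure0 : image_measure set0 = 0%E.
Proof. exact: measure0. Qed.

Let image_measure_ge0 A : (0 <= image_measure A)%E.
Proof. exact: measure_ge0. Qed.

Let image_measure_sigma_additive : semi_sigma_additive image_measure.
Proof. exact: measure_semi_sigma_additive. Qed.

HB.instance Definition _ := isMeasure.Build _ _ _ image_measure
  image_measure0 image_measure_ge0 image_measure_sigma_additive.

End image_measure.

(* Lebesgue measure on R^n: iterated product measure on n-tuples, transported
   to row vectors. *)
Section lebesgue_measure_rV.
Context {R : realType}.

Definition tuple_cons (n : nat) (p : n.-tuple R * measurableTypeR R) :
    n.+1.-tuple R :=
  [the n.+1.-tuple R of p.2 :: p.1].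

Lemma measurable_tuple_cons n : measurable_fun setT (@tuple_cons n).
Proof. exact: (measurable_cons measurable_snd measurable_fst). Qed.

HB.instance Definition _ n :=
  isMeasurableFun.Build _ _ _ _ (@tuple_cons n) (@measurable_tuple_cons n).

Fixpoint lebesgue_measure_tuple (n : nat) :
    {measure set (n.-tuple R) -> \bar R} :=
  match n with
  | 0 => [the measure _ _ of \d_ [tuple]]
  | n'.+1 => [the measure _ _ of
      image_measure (lebesgue_measure_tuple n' \x lebesgue_measure)%E
        (@tuple_cons n')]
  end.

Definition rV_of_tuple (n : nat) (t : n.-tuple R) : 'rV[R]_n := \row_i tnth t i.

Let box n (a : {ffun 'I_n -> rat} * nat) : set 'rV[R]_n :=
  [set v | forall i, `|ratr (a.1 i) - v 0 i| < a.2.+1%:R^-1].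

Let open_rV_bigcup n (U : set 'rV[R]_n) : open U ->
  U = \bigcup_(a in [set a | box a `<=` U]) @box n a.
Proof.
move=> oU; apply/seteqP; split => [v Uv|v [a /= aU]]; last exact: aU.
have /nbhs_ballP[e /= e0 veU] := open_nbhs_nbhs (conj oU Uv).
pose k := Num.truncn (2 / e).
have ke : k.+1%:R^-1 < e / 2.
  by rewrite invf_plt ?posrE ?divr_gt0// invf_div truncnS_gt.
have k0 : 0 < k.+1%:R^-1 :> R by rewrite invr_gt0.
have /choice[q qv] : forall i, exists q : rat, `|ratr q - v 0 i| < k.+1%:R^-1.
  move=> i; have := @rat_in_itvoo R (v 0 i - k.+1%:R^-1) (v 0 i + k.+1%:R^-1).
  rewrite ltrBlDr -addrA ltrDl addr_gt0// => /(_ isT)[q].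
  by rewrite in_itv/= => qv; exists q; rewrite ltr_distl.
exists ([ffun i => q i], k) => /=; last by move=> i/=; rewrite ffunE.
move=> w /= qw; apply: veU; split => // i j; rewrite (ord1 i) /ball/=.
rewrite (splitr e) -(subrKA (ratr (q j))).
apply: (le_lt_trans (ler_normD _ _)); apply: ltrD.
  by rewrite distrC; exact: lt_trans (qv j) ke.
by have := qw j; rewrite ffunE => /lt_trans; exact.
Qed.

Lemma measurable_rV_of_tuple n : measurable_fun setT (@rV_of_tuple n).
Proof.
apply: (measurability (@open 'rV[R]_n)) => //.
move=> _ [U oU <-]; rewrite setTI (open_rV_bigcup oU) preimage_bigcup.
rewrite bigcup_mkcond; apply: countable_bigcupT_measurable => // a.
case: ifPn => // _.
rewrite (_ : _ @^-1` _ = \bigcap_(i in [set: 'I_n])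
    ((fun t : n.-tuple R => tnth t i) @^-1`
      [set x | `|ratr (a.1 i) - x| < a.2.+1%:R^-1])); last first.
  apply/seteqP; split=> t /=.
    by move=> h i _ /=; have := h i; rewrite mxE.
  by move=> h i; rewrite mxE; exact: h.
apply: fin_bigcap_measurable => // i _.
rewrite -[X in measurable X]setTI; apply: measurable_tnth => //.
by apply: open_measurable; exact: (@ball_open _ R (ratr (a.1 i)) _).
Qed.

HB.instance Definition _ n :=
  isMeasurableFun.Build _ _ _ _ (@rV_of_tuple n) (@measurable_rV_of_tuple n).

Definition lebesgue_measure_rV (n : nat) : {measure set 'rV[R]_n -> \bar R} :=
  [the measure _ _ of image_measure (lebesgue_measure_tuple n) (@rV_of_tuple n)].

End lebesgue_measure_rV.

Section euclidean.
Context {R : realType}.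

(* The library norm `|z| on 'rV[R]_m is the sup norm. *)
Definition enorm (m : nat) (z : 'rV[R]_m) : R := Num.sqrt (\sum_i z 0 i ^+ 2).

Definition unit_sphere (m : nat) : set 'rV[R]_m := [set z | enorm z = 1].

Definition strictly_convex (m : nat) (f : 'rV[R]_m -> R) :=
  forall (x y : 'rV[R]_m) (t : R), x != y -> 0 < t -> t < 1 ->
    f (t *: x + (1 - t) *: y) < t * f x + (1 - t) * f y.

End euclidean.
Arguments unit_sphere {R} m.

Section integrands.
Context {R : realType} (m : nat).
Implicit Types f : 'rV[R]_m -> R.

Definition classA (f0 : 'rV[R]_m -> R) : Prop :=
  [/\ continuous f0,
      exists C : R, forall z, `|f0 z| <= C,
      forall z, unit_sphere m z -> cvg (f0 (s *: z) @[s --> +oo]) &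
      {within unit_sphere m, continuous (fun z => lim (f0 (s *: z) @[s --> +oo]))}].

Definition classF2 f : Prop :=
  continuous f /\
  exists2 f0, classA f0 & f = (fun z => (1 + enorm z ^+ 2) * f0 z).

Definition recession f (z : 'rV[R]_m) : R :=
  lim (f (s *: z) / (1 + s ^+ 2) @[s --> +oo]).

End integrands.

(* Measurability with respect to the mu-completion of the sigma-algebra of T.
   The library integral is defined for arbitrary functions, through suprema of
   integrals of simple functions below the positive and negative parts; for
   h as below it is the integral against the completion of mu. *)
Definition mu_measurable d (T : measurableType d) (R : realType)
    (mu : set T -> \bar R) (D : set T) (h : T -> \bar R) : Prop :=
  exists2 h' : T -> \bar R, measurable_fun D h' &
    {ae mu, forall x, D x -> h x = h' x}.

Section Linfty_weak.
Context d (T : measurableType d) (R : realType) (m : nat).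
Local Open Scope ereal_scope.

(* L^infty_weak(D, mu; P(X)) for a Borel set X of R^m.  Measures on X are
   encoded as the Borel measures on R^m concentrated on X, and maps on D as
   total maps, whose values outside D are irrelevant. *)
Definition Linfty_weak (mu : set T -> \bar R) (D : set T) (X : set 'rV[R]_m)
    (nu : T -> probability 'rV[R]_m R) : Prop :=
  (forall x, D x -> nu x X = 1) /\
  (forall g : 'rV[R]_m -> R, measurable_fun X g ->
    (exists C : R, forall z, X z -> (`|g z| <= C)%R) ->
    mu_measurable mu D (fun x => \int[nu x]_(z in X) (g z)%:E)).

End Linfty_weak.

Section young_measures.
Context {R : realType} (n m : nat).
Local Open Scope ereal_scope.

Local Notation dx := (@lebesgue_measure_rV R n).

Record young_triple := YoungTriple {
  osc : 'rV[R]_n -> probability 'rV[R]_m R ;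
  conc : {finite_measure set 'rV[R]_n -> \bar R} ;
  conc_angle : 'rV[R]_n -> probability 'rV[R]_m R }.
Implicit Types y : young_triple.

(* < nu_x , g > *)
Definition osc_pairing y (g : 'rV[R]_m -> R) (x : 'rV[R]_n) : \bar R :=
  \int[osc y x]_z (g z)%:E.

(* < nu^infty_x , h >, with h only relevant on the sphere *)
Definition conc_pairing y (h : 'rV[R]_m -> R) (x : 'rV[R]_n) : \bar R :=
  \int[conc_angle y x]_(z in unit_sphere m) (h z)%:E.

Definition barycenter y (x : 'rV[R]_n) : 'rV[R]_m :=
  \row_i (\int[osc y x]_z z ord0 i)%R.

(* The set Y.  Finite Borel measures on R^n are Radon. *)
Definition young_measure (Omega : set 'rV[R]_n) : set young_triple :=
  [set y | [/\ Linfty_weak dx Omega setT (osc y),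
    conc y (~` closure Omega) = 0,
    Linfty_weak (conc y) (closure Omega) (unit_sphere m) (conc_angle y) &
    \int[dx]_(x in Omega) osc_pairing y (fun z => enorm z ^+ 2)%R x +
      conc y (closure Omega) < +oo]].

(* The measure < nu_x , g > dx + < nu^infty_x , g^infty > lambda on the closure
   of Omega. *)
Definition young_pairing (Omega : set 'rV[R]_n) y (g : 'rV[R]_m -> R)
    (A : set 'rV[R]_n) : \bar R :=
  \int[dx]_(x in Omega `&` A) osc_pairing y g x +
  \int[conc y]_(x in closure Omega `&` A) conc_pairing y (recession g) x.

Definition is_convex_combination (Omega : set 'rV[R]_n) (t : R) y1 y2 y : Prop :=
  forall g, classF2 g -> forall A, measurable A -> A `<=` closure Omega ->
    young_pairing Omega y g A =
      t%:E * young_pairing Omega y1 g A + (1 - t)%:E * young_pairing Omega y2 g A.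

(* The identity determines a convex combination only up to null sets, that is,
   as an element of Y with its components identified a.e.; the existential
   expresses that this element is represented in M. *)
Definition convex_set_of_young_measures (Omega : set 'rV[R]_n)
    (M : set young_triple) : Prop :=
  M `<=` young_measure Omega /\
  forall (t : R) y1 y2, (0 <= t <= 1)%R -> M y1 -> M y2 ->
    exists2 y, M y & is_convex_combination Omega t y1 y2 y.

Definition young_variance (Omega : set 'rV[R]_n) (f : 'rV[R]_m -> R) y : \bar R :=
  \int[dx]_(x in Omega) (osc_pairing y f x - (f (barycenter y x))%:E) +
  \int[conc y]_(x in closure Omega) conc_pairing y (recession f) x.

Definition maximal_in (M : set young_triple) (V : young_triple -> \bar R) y : Prop :=
  M y /\ forall y', M y' -> V y' <= V y.

End young_measures.

(* Main.v *)
Require Import Defs.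
From mathcomp Require Import all_boot all_order all_algebra.
From mathcomp Require Import all_classical all_reals all_analysis.
From mathcomp Require Import measurable_realfun lra.
Import Order.TTheory GRing.Theory Num.Theory.
Import numFieldNormedType.Exports.
Local Open Scope classical_set_scope.
Local Open Scope ring_scope.

(* Test the convexity of M on the midpoint of y1 and y2.  The energy
   E = int <nu, f> dx + int <nu^infty, f^infty> dlambda and, testing with the
   coordinate functions (whose recession functions vanish), the barycenter are
   affine along it.  As V_f = E - int f(barycenter) dx is maximal at y1 and y2,
   the integral of f(barycenter) at the midpoint is at least the mean of those
   at y1 and y2; strict convexity of f then forces the barycenters of y1 and y2
   to agree a.e., and equality of the variances becomes equality of the
   energies. *)

Set Implicit Arguments.
Unset Strict Implicit.
Unset Printing Implicit Defensive.

(** * Integrals of functions that are measurable only up to null sets *)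

(* The pairings are only a.e. equal to measurable functions, hence these lemmas
   work directly with the definition of the integral as a supremum over simple
   functions. *)
Section integral_without_measurability.
Context d (T : measurableType d) (R : realType) (mu : {measure set T -> \bar R}).
Local Open Scope ereal_scope.
Implicit Types (D : set T) (f g : T -> \bar R).

(** Every simple function below the restriction of [f] to [D] is also below that of [g], so the left
    integral is a supremum over a smaller set. *)
Lemma nonmeasurable_ge0_le_integral D f g : (forall x, D x -> 0 <= f x) ->
  (forall x, D x -> f x <= g x) -> \int[mu]_(x in D) f x <= \int[mu]_(x in D) g x.
Proof.
move=> f0 fg.
have g0 x : D x -> 0 <= g x by move=> Dx; exact: le_trans (f0 x Dx) (fg x Dx).
rewrite !ge0_integralE//; apply: ereal_sup_le => _ [h /= hf <-]; exists h => //= x.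
apply: le_trans (hf x) _; rewrite !patchE; case: ifPn => // /set_mem; exact: fg.
Qed.

(** Sandwich argument: with [h c] equal to [c] on the null set [N] and to [g] elsewhere,
    [h 0 <= f <= h +oo] on [D]. Both bounds are measurable and have the integral of [g]. *)
Lemma ge0_ae_eq_nonmeasurable_integral D f g : measurable D ->
  measurable_fun D g -> (forall x, D x -> 0 <= f x) ->
  (forall x, D x -> 0 <= g x) -> {ae mu, forall x, D x -> f x = g x} ->
  \int[mu]_(x in D) f x = \int[mu]_(x in D) g x.
Proof.
move=> mD mg f0 g0 [N [mN N0 fgN]].
have fgE x : D x -> ~ N x -> f x = g x.
  by move=> Dx Nx; apply: contrapT => h; apply/Nx/fgN => /(_ Dx).
pose h (c : \bar R) x := if x \in N then c else g x.
have mh c : measurable_fun D (h c).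
  apply: measurable_fun_if => //.
  - apply: (measurable_fun_bool true).
    rewrite (_ : _ @^-1` _ = N); first exact: measurableI.
    by apply/seteqP; split=> x /=; [move/set_mem|move=> Nx; exact/mem_set].
  - by apply: measurable_funS mg => // x [].
have gh c : 0 <= c -> \int[mu]_(x in D) g x = \int[mu]_(x in D) h c x.
  move=> c0; apply: ge0_ae_eq_integral => //.
    by move=> x Dx; rewrite /h; case: ifP => // _; exact: g0.
  exists N; split => // x /= /not_implyP[Dx]; rewrite /h.
  by case: ifPn => // /set_mem.
apply/eqP; rewrite eq_le; apply/andP; split.
- rewrite (gh +oo)//; apply: nonmeasurable_ge0_le_integral => // x Dx.
  rewrite /h; case: ifPn; rewrite ?leey// => /negP xN; rewrite fgE// => Nx.
  by apply: xN; exact/mem_set.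
- rewrite (gh 0)//; apply: nonmeasurable_ge0_le_integral => x Dx;
    rewrite /h; case: ifPn => // xN; [exact: g0|exact: f0|].
  by rewrite fgE// => Nx; move/negP: xN; apply; exact/mem_set.
Qed.

Lemma ae_eq_nonmeasurable_integral D f g : measurable D ->
  measurable_fun D g -> {ae mu, forall x, D x -> f x = g x} ->
  \int[mu]_(x in D) f x = \int[mu]_(x in D) g x.
Proof.
move=> mD mg /ae_eq_funeposneg[fgp fgn].
rewrite integralE [RHS]integralE; congr (_ - _).
- by apply: ge0_ae_eq_nonmeasurable_integral => //; exact: measurable_funepos.
- by apply: ge0_ae_eq_nonmeasurable_integral => //; exact: measurable_funeneg.
Qed.

(** The measurable representatives [v k] may fail to converge on a null set, so the limit is
    represented by their upper limit. The countably many exceptional sets are merged into one. *)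
Lemma mu_measurable_cvg D (u : (T -> \bar R)^nat) f :
  (forall k, mu_measurable mu D (u k)) ->
  (forall x, D x -> u k x @[k --> \oo] --> f x) -> mu_measurable mu D f.
Proof.
move=> mu_u uf.
have /choice[v vP] : forall k, exists v : T -> \bar R,
    measurable_fun D v /\ {ae mu, forall x, D x -> u k x = v x}.
  by move=> k; have [v] := mu_u k; exists v.
exists (fun x => limn_esup (v ^~ x)).
  by apply: measurable_fun_limn_esup => k; exact: (vP k).1.
have : {ae mu, forall x k, D x -> u k x = v k x}.
  by apply/ae_foralln => k; exact: (vP k).2.
apply: filterS => x uv Dx; rewrite (_ : v ^~ x = u ^~ x).
  by have /cvg_limn_einf_sup[_ ->] := uf _ Dx.
by apply/funext => k; rewrite uv.
Qed.

End integral_without_measurability.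

(** * Borel sets of row vectors and finiteness of Lebesgue measure on bounded sets *)

Section borel_rV.
Context {R : realType}.

Lemma continuous_measurable_rV m (g : 'rV[R]_m -> R) :
  continuous g -> measurable_fun setT g.
Proof.
move=> cg; apply: (measurability _ (RGenOpens.measurableE R)) => //.
move=> _ [U [a [b ->]] <-]; rewrite setTI; apply: sub_sigma_algebra.
by apply: open_comp => // x _; exact: cg.
Qed.

Lemma measurable_fun_row d (T : measurableType d) (D : set T) m
    (p : 'I_m -> T -> R) : measurable D ->
  (forall i, measurable_fun D (p i)) ->
  measurable_fun D (fun x => \row_i p i x : 'rV[R]_m).
Proof.
move=> mD mp.
(* Extending the coordinates by 0 outside [D] gives a map on all of [T], which factors through
   tuples, where measurability is coordinatewise. *)
apply: (eq_measurable_fun (fun x => \row_i (p i \_ D) x)).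
  by move=> x xD; apply/rowP => i; rewrite !mxE patchE xD.
apply: (measurable_funS measurableT) => //.
rewrite (_ : (fun x => _) =
    @rV_of_tuple R m \o (fun x => mktuple (fun i => (p i \_ D) x))).
  apply: measurableT_comp; first exact: measurable_rV_of_tuple.
  apply/measurable_fun_tnthP => i.
  rewrite (_ : _ \o _ = p i \_ D); last first.
    by apply/funext => x /=; rewrite tnth_mktuple.
  by apply/measurable_restrict => //; rewrite setTI.
by apply/funext => x; apply/rowP => i; rewrite !mxE tnth_mktuple.
Qed.

Lemma open_measurable_rV m (U : set 'rV[R]_m) : open U -> measurable U.
Proof. exact: sub_sigma_algebra. Qed.

Lemma closed_measurable_rV m (U : set 'rV[R]_m) : closed U -> measurable U.
Proof.
move=> cU; rewrite -(setCK U); apply: measurableC.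
by apply: open_measurable_rV; exact: closed_openC.
Qed.

Lemma measurable_tuple_cube n (r : R) :
  measurable [set t : n.-tuple R | forall i, `|tnth t i| <= r].
Proof.
rewrite (_ : mkset _ = \bigcap_(i in [set: 'I_n])
    ((fun t : n.-tuple R => tnth t i) @^-1` [set x | `|x| <= r])); last first.
  by apply/seteqP; split=> t /= h i; [move=> _|]; exact: (h i).
apply: fin_bigcap_measurable => // i _.
rewrite -[X in measurable X]setTI; apply: measurable_tnth => //.
rewrite (_ : mkset _ = `[- r, r]%classic); first exact: measurable_itv.
by apply/seteqP; split=> x /=; rewrite in_itv /= ler_norml.
Qed.

(** By induction on [n]: the preimage of the cube under [tuple_cons] is the product of the
    lower-dimensional cube and [[- r, r]]. *)
Lemma lebesgue_measure_tuple_cube n (r : R) :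
  (lebesgue_measure_tuple n
     [set t : n.-tuple R | forall i, `|tnth t i| <= r]%R < +oo)%E.
Proof.
elim: n => [|n IH] /=.
  rewrite diracE; exact: ltry.
rewrite /image_measure /pushforward.
rewrite (_ : _ @^-1` _ = [set t : n.-tuple R | forall i, `|tnth t i| <= r]
    `*` `[- r, r]%classic); last first.
  apply/seteqP; split => -[t x] /=.
    move=> h; split.
      by move=> i; have := h (lift ord0 i); rewrite tnthS.
    by have := h ord0; rewrite tnth0 /= in_itv /= ler_norml.
  move=> [ht hx] i; case: (unliftP ord0 i) => [j ->|->].
    by rewrite tnthS.
  by rewrite tnth0; move: hx; rewrite /= in_itv /= -ler_norml.
rewrite product_measure1E//; last exact: measurable_tuple_cube.
apply: lte_mul_pinfty.
- exact: measure_ge0.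
- by rewrite ge0_fin_numE ?measure_ge0.
- have := @lebesgue_measure_itv R `[- r, r]; rewrite /= => ->.
  by case: ifP; rewrite ltry.
Qed.

Lemma bounded_lebesgue_measure_rV n (D : set 'rV[R]_n) :
  measurable D -> bounded_set D -> (lebesgue_measure_rV n D < +oo)%E.
Proof.
move=> mD [M [Mreal DM]].
apply: le_lt_trans (lebesgue_measure_tuple_cube n (M + 1)).
rewrite /= /image_measure /pushforward le_measure ?inE//.
- rewrite -[X in measurable X]setTI; exact: measurable_rV_of_tuple.
- exact: measurable_tuple_cube.
(* Boundedness provides a bound for every radius strictly above [M], hence [M + 1]; the norm is the
   sup norm, so it dominates each coordinate. *)
- move=> t /= Dt i; have /(DM _) /(_ _ Dt) : M < M + 1 by rewrite ltrDl.
  apply: le_trans; rewrite [leRHS]/Num.Def.normr/= mx_normrE.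
  by apply: le_trans (le_bigmax _ _ (ord0, i)); rewrite mxE.
Qed.

End borel_rV.

(** * Quadratic growth, recession functions and coordinate functions *)

Section integrands.
Context {R : realType} {m : nat}.
Implicit Types (z : 'rV[R]_m) (f : 'rV[R]_m -> R).

Lemma enorm_ge0 z : 0 <= enorm z.
Proof. exact: sqrtr_ge0. Qed.

Lemma sqr_enorm z : enorm z ^+ 2 = \sum_i z 0 i ^+ 2.
Proof. by rewrite sqr_sqrtr// sumr_ge0// => i _; exact: sqr_ge0. Qed.

Lemma sqr_coord_le_enorm z i : z 0 i ^+ 2 <= enorm z ^+ 2.
Proof.
by rewrite sqr_enorm (bigD1 i)//= lerDl sumr_ge0// => j _; exact: sqr_ge0.
Qed.

Lemma enormZ (s : R) z : enorm (s *: z) ^+ 2 = s ^+ 2 * enorm z ^+ 2.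
Proof.
by rewrite !sqr_enorm mulr_sumr; apply: eq_bigr => i _; rewrite mxE exprMn.
Qed.

Lemma continuous_coord i : continuous (fun z => z 0 i).
Proof. by move=> z; exact: coord_continuous. Qed.

Lemma continuous_sqr_enorm : continuous (fun z => enorm z ^+ 2).
Proof.
rewrite (_ : (fun z => _) = (fun z => \sum_i z 0 i ^+ 2)); last first.
  by apply/funext => z; rewrite sqr_enorm.
have coord2 i : continuous (fun z => z 0 i ^+ 2).
  by move=> z; exact: (continuousM (@continuous_coord i z) (@continuous_coord i z)).
elim: (index_enum _) => [|i r IH] z.
  rewrite (_ : (fun _ => _) = cst 0); first exact: cst_continuous.
  by apply/funext => w; rewrite big_nil.
rewrite (_ : (fun _ => _) = (fun w : 'rV[R]_m => w 0 i ^+ 2) \+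
    (fun w : 'rV[R]_m => \sum_(j <- r) w 0 j ^+ 2)).
  exact: (continuousD (coord2 i z) (IH z)).
by apply/funext => w; rewrite big_cons.
Qed.

Lemma coord_bound z i : `|z 0 i| <= 1 + enorm z ^+ 2.
Proof.
have := sqr_coord_le_enorm z i; set x := z 0 i => xe.
by rewrite ler_norml; apply/andP; split; nra.
Qed.

Lemma cvg_linear_over_quadratic (c : R) :
  s * c / (1 + s ^+ 2) @[s --> +oo] --> (0 : R).
Proof.
apply/cvgr0Pnorm_lt => e e0; near=> s.
have s0 : 0 < s by near: s; apply: nbhs_pinfty_gt; exact: num_real.
(* Beyond this threshold, [s * |c| < e * s ^+ 2 < e * (1 + s ^+ 2)]. *)
have sc : `|c| / e < s by near: s; apply: nbhs_pinfty_gt; exact: num_real.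
have q0 : 0 < 1 + s ^+ 2 by rewrite ltr_pwDl// sqr_ge0.
rewrite normrM normrV ?unitfE ?gt_eqF// (gtr0_norm q0) ltr_pdivrMr//.
rewrite normrM (gtr0_norm s0).
by move: sc; rewrite ltr_pdivrMr// => sc; nra.
Unshelve. all: by end_near. Qed.

Lemma recession_coord i z : recession (fun z : 'rV[R]_m => z 0 i) z = 0.
Proof.
apply/cvg_lim => //; rewrite [X in X @ _ --> _](_ : _ =
  (fun s : R => s * z 0 i / (1 + s ^+ 2))).
  exact: cvg_linear_over_quadratic.
by apply/funext => s; rewrite mxE.
Qed.

(** Linear growth is negligible against [1 + |z|^2]: the quotient is bounded by 1 and tends to 0
    along every ray. Coordinates are thus admissible test functions, and they see only the
    oscillation part. *)
Lemma classF2_coord i : classF2 (fun z : 'rV[R]_m => z 0 i).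
Proof.
have q0 z : 1 + enorm z ^+ 2 != 0 by rewrite gt_eqF// ltr_pwDl// sqr_ge0.
split; first exact: continuous_coord.
exists (fun z => z 0 i / (1 + enorm z ^+ 2)); last first.
  by apply/funext => z; rewrite mulrC divfK.
have scale_lim z : unit_sphere m z ->
    (s *: z) 0 i / (1 + enorm (s *: z) ^+ 2) @[s --> +oo] --> (0 : R).
  move=> z1; rewrite [X in X @ _ --> _](_ : _ =
    (fun s : R => s * z 0 i / (1 + s ^+ 2))).
    exact: cvg_linear_over_quadratic.
  by apply/funext => s; rewrite mxE enormZ z1 expr1n mulr1.
split.
- move=> z; apply: (continuousM (@continuous_coord i z)).
  apply: continuousV => //.
  by apply: continuousD; [exact: cst_continuous|exact: continuous_sqr_enorm].
- exists 1 => z; have h0 : 0 < 1 + enorm z ^+ 2 by rewrite ltr_pwDl// sqr_ge0.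
  rewrite normrM normrV ?unitfE// (gtr0_norm h0) ler_pdivrMr// mul1r.
  exact: coord_bound.
- by move=> z z1; apply/cvg_ex; exists 0; exact: scale_lim.
- apply: (@subspace_eq_continuous _ _ _ (cst 0)); last exact: cst_continuous.
  by move=> z /set_mem z1; apply/esym/cvg_lim => //; exact: scale_lim.
Qed.

Lemma classF2_quadratic_bound f : classF2 f ->
  exists C : R, [/\ 0 <= C, forall z, `|f z| <= C * (1 + enorm z ^+ 2) &
    forall z, unit_sphere m z -> (forall w, 0 <= f w) ->
      0 <= recession f z <= C].
Proof.
move=> [_ [f0 [_ [C f0C] f0_lim _] fE]].
have C0 : 0 <= C by apply: le_trans (f0C 0).
have q0 z : 0 < 1 + enorm z ^+ 2 by rewrite ltr_pwDl// sqr_ge0.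
exists C; split => // z.
  by rewrite fE normrM (gtr0_norm (q0 z)) mulrC ler_wpM2r// ltW.
move=> z1 f_ge0; rewrite /recession.
(* On the unit sphere [|s z|^2 = s^2], so the recession quotient is exactly [f0 (s *: z)] and its
   limit inherits the bounds on [f0]. *)
have -> : (fun s : R => f (s *: z) / (1 + s ^+ 2)) = (fun s => f0 (s *: z)).
  apply/funext => s; rewrite fE enormZ z1 expr1n mulr1 mulrC mulKf//.
  by rewrite gt_eqF// ltr_pwDl// sqr_ge0.
have f0_ge0 w : 0 <= f0 w.
  by have := f_ge0 w; rewrite fE pmulr_rge0.
apply/andP; split.
- by apply: limr_ge; [exact: f0_lim|exact: nearW].
- apply: limr_le; [exact: f0_lim|apply: nearW => s].
  by apply: le_trans (f0C (s *: z)); exact: ler_norm.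
Qed.

End integrands.

(** * Domination and differences up to null sets *)

Section mu_measurable_theory.
Context d (T : measurableType d) (R : realType) (mu : {measure set T -> \bar R}).
Local Open Scope ereal_scope.

Lemma ae_le_integrable (D : set T) (p q : T -> \bar R) : measurable D ->
  measurable_fun D p -> {ae mu, forall x, D x -> `|p x| <= `|q x|} ->
  mu.-integrable D q -> mu.-integrable D p.
Proof.
move=> mD mp pq /integrableP[mq qoo]; apply/integrableP; split => //.
apply: le_lt_trans qoo; apply: ae_ge0_le_integral => //; exact: measurableT_comp.
Qed.

Lemma mu_measurable_sub (D : set T) (p q : T -> \bar R) : measurable D ->
  mu_measurable mu D p -> mu_measurable mu D q ->
  mu_measurable mu D (fun x => p x - q x).
Proof.
move=> mD [p' mp pp'] [q' mq qq']; exists (fun x => p' x - q' x).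
  exact: emeasurable_funB.
by apply: filterS2 pp' qq' => x pE qE Dx; rewrite pE// qE.
Qed.

End mu_measurable_theory.

(** * Moment estimates for a single probability measure *)

Section probability_rV.
Context {R : realType} {m : nat} (P : probability 'rV[R]_m R).
Local Open Scope ereal_scope.
Implicit Types g : 'rV[R]_m -> R.

Let mesq : measurable_fun setT (fun z : 'rV[R]_m => enorm z ^+ 2)%R.
Proof. by apply: continuous_measurable_rV; exact: continuous_sqr_enorm. Qed.

Let integral_probability_cst (c : \bar R) : \int[P]_z c = c.
Proof.
transitivity (c * P setT); first exact: integral_cst.
by rewrite [X in _ * X](_ : _ = 1) ?mule1//; exact: probability_setT.
Qed.

Lemma integral_le_quadratic g (C : R) : measurable_fun setT g -> (0 <= C)%R ->
  (forall z, `|g z| <= C * (1 + enorm z ^+ 2))%R ->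
  `|\int[P]_z (g z)%:E| <= C%:E * (1 + \int[P]_z (enorm z ^+ 2)%:E).
Proof.
move=> mg C0 gC.
apply: le_trans (le_abse_integral _ measurableT _) _; first exact/measurable_EFinP.
apply: (@le_trans _ _ (\int[P]_z (C%:E * (1 + (enorm z ^+ 2)%:E)))).
  by apply: nonmeasurable_ge0_le_integral => // z _; rewrite /= lee_fin.
rewrite ge0_integralZl_EFin//; last 2 first.
- by move=> z _; rewrite adde_ge0// lee_fin sqr_ge0.
- by apply: emeasurable_funD => //; exact/measurable_EFinP.
rewrite ge0_integralD//; last 2 first.
- by move=> z _; rewrite lee_fin sqr_ge0.
- exact/measurable_EFinP.
by rewrite integral_probability_cst.
Qed.

(* Jensen's inequality, from integrating [2 b (g - b) <= g^2 - b^2]. *)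
Lemma sqr_integral_le g (b s : R) : measurable_fun setT g ->
  (forall z, g z ^+ 2 <= enorm z ^+ 2)%R ->
  \int[P]_z (g z)%:E = b%:E -> \int[P]_z (enorm z ^+ 2)%:E = s%:E ->
  (b ^+ 2 <= s)%R.
Proof.
move=> mg gC gb es.
have ie : P.-integrable setT (fun z : 'rV[R]_m => (enorm z ^+ 2)%:E).
  apply/integrableP; split; first exact/measurable_EFinP.
  under eq_integral => z _ do rewrite gee0_abs ?lee_fin ?sqr_ge0//.
  by rewrite es ltry.
have i1 (c : R) : P.-integrable setT (EFin \o cst c).
  exact: finite_measure_integrable_cst.
have ig : P.-integrable setT (EFin \o g).
  apply: (@le_integrable _ _ _ _ _ _ _ (fun z => 1 + (enorm z ^+ 2)%:E)) => //.
  - exact/measurable_EFinP.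
  - move=> z _ /=; rewrite lee_fin [leRHS]ger0_norm ?addr_ge0 ?sqr_ge0//.
    (* The squares of [x - 1] and [x + 1] give [2 |x| <= 1 + x^2 <= 1 + e]. *)
    have := gC z; move: (g z) (enorm z ^+ 2)%R => x e xe.
    have := sqr_ge0 (x - 1)%R; have := sqr_ge0 (x + 1)%R.
    by rewrite ler_norml => ? ?; apply/andP; split; nra.
  - exact: (integrableD measurableT (i1 1%R) ie).
have : \int[P]_z ((2 * b)%:E * (g z)%:E - (b ^+ 2)%:E) <=
    \int[P]_z (enorm z ^+ 2)%:E.
  apply: le_integral => //.
  - apply: (integrableB measurableT _ (i1 (b ^+ 2)%R)).
    exact: integrableZl.
  - move=> z _; rewrite lee_fin; have := gC z.
    move: (g z) (enorm z ^+ 2)%R => x e xe.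
    by have := sqr_ge0 (x - b)%R; nra.
rewrite integralB//; [|exact: integrableZl|exact: (i1 (b ^+ 2)%R)].
rewrite integralZl// gb es integral_probability_cst.
by rewrite lee_fin; nra.
Qed.

End probability_rV.

(** * Weak measurability for unbounded integrands *)

Section Linfty_weak_unbounded.
Context d (T : measurableType d) (R : realType) (m : nat).
Context (mu : {measure set T -> \bar R}) (D : set T).
Context (nu : T -> probability 'rV[R]_m R).
Hypotheses (mD : measurable D) (nuL : Linfty_weak mu D setT nu).
Local Open Scope ereal_scope.

(** The definition tests only bounded functions. The truncations [min (g, k)] are bounded and
    increase to [g], so monotone convergence passes measurability to the limit. *)
Lemma Linfty_weak_ge0 (g : 'rV[R]_m -> R) : measurable_fun setT g ->
  (forall z, 0 <= g z)%R -> mu_measurable mu D (fun x => \int[nu x]_z (g z)%:E).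
Proof.
move=> mg g0.
pose trunc k z : R := Order.min (g z) k%:R.
have mtrunc k : measurable_fun setT (trunc k).
  by apply: measurable_minr => //; exact: measurable_cst.
have trunc0 k z : (0 <= trunc k z)%R by rewrite /trunc le_min g0 ler0n.
apply: (@mu_measurable_cvg _ _ _ mu D
  (fun k x => \int[nu x]_(z in setT) (trunc k z)%:E)).
  move=> k; apply: nuL.2 => //; exists k%:R => z _.
  by rewrite ger0_norm// /trunc ge_min lexx orbT.
move=> x Dx.
rewrite (_ : \int[_]_z _ = \int[nu x]_(z in setT) limn (fun k => (trunc k z)%:E)).
  apply: cvg_monotone_convergence => //.
  - by move=> k; exact/measurable_EFinP.
  - by move=> k z _; rewrite lee_fin.
  - move=> z _ k l kl; rewrite lee_fin /trunc le_min !ge_min lexx/=.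
    by rewrite ler_nat kl orbT.
apply: eq_integral => z _; apply/esym/lim_near_cst => //.
near=> k; congr EFin; apply/min_idPl.
near: k; exists (Num.truncn (g z)).+1 => // k /= gk.
by apply: le_trans (ltW (truncnS_gt _)) _; rewrite ler_nat.
Unshelve. all: by end_near. Qed.

(** The integral is by definition the difference of those of the positive and negative parts, even
    where both are infinite. *)
Lemma Linfty_weak_measurable (g : 'rV[R]_m -> R) : measurable_fun setT g ->
  mu_measurable mu D (fun x => \int[nu x]_z (g z)%:E).
Proof.
move=> mg.
rewrite (_ : (fun x => _) = (fun x =>
    \int[nu x]_z (g^\+%R z)%:E - \int[nu x]_z (g^\-%R z)%:E)).
  apply: mu_measurable_sub => //; apply: Linfty_weak_ge0.
  - exact: measurable_funrpos.
  - exact: funrpos_ge0.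
  - exact: measurable_funrneg.
  - exact: funrneg_ge0.
apply/funext => x; rewrite integralE; congr (_ - _).
- by rewrite [LHS](_ : _ = \int[nu x]_z ((EFin \o g)^\+ z))// funerpos.
- by rewrite [LHS](_ : _ = \int[nu x]_z ((EFin \o g)^\- z))// funerneg.
Qed.

End Linfty_weak_unbounded.

(** * Real-valued integrable representatives of the pairings of a Young measure *)

Section young_representatives.
Context {R : realType} {n m : nat} (Omega : set 'rV[R]_n) (y : @young_triple R n m).
Hypotheses (mOmega : measurable Omega).
Hypotheses (Omega_fin : (lebesgue_measure_rV n Omega < +oo)%E).
Hypotheses (yY : young_measure Omega y).
Local Open Scope ereal_scope.
Local Notation dx := (@lebesgue_measure_rV R n).

Let esq (z : 'rV[R]_m) : R := (enorm z ^+ 2)%R.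

Let mesq : measurable_fun setT esq.
Proof. by apply: continuous_measurable_rV; exact: continuous_sqr_enorm. Qed.

Let osc_esq_ge0 x : 0 <= osc_pairing y esq x.
Proof. by apply: integral_ge0 => z _; rewrite lee_fin sqr_ge0. Qed.

Lemma young_measure_moment : exists s : 'rV[R]_n -> R,
  [/\ forall x, (0 <= s x)%R, dx.-integrable Omega (EFin \o s) &
  {ae dx, forall x, Omega x -> osc_pairing y esq x = (s x)%:E}].
Proof.
have [nuL _ _ yfin] := yY.
have [h mh hE] := @Linfty_weak_measurable _ _ _ _ dx _ _ mOmega nuL esq mesq.
have {}hE : {ae dx, forall x, Omega x -> osc_pairing y esq x = h x} by [].

(* The concentration mass is non-negative, so the finite total in the definition of a Young measure
   bounds the second moment term. *)
have hoo : \int[dx]_(x in Omega) `|h x| < +oo.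
  rewrite -(@ae_eq_nonmeasurable_integral _ _ _ _ _ (osc_pairing y esq))//.
  - by apply: le_lt_trans yfin; rewrite leeDl.
  - exact: measurableT_comp.
  - by apply: filterS hE => x hx Ox; rewrite -hx// gee0_abs.
have ih : dx.-integrable Omega h by exact/integrableP.
have hfin := integrable_ae mOmega ih.
(* [fine] sends infinite values to 0 and the absolute value makes [s] non-negative everywhere;
   within [Omega] this alters the moment only on a null set. *)
exists (fun x => `|fine (h x)|%R); split => //.
- apply: (ae_le_integrable _ _ _ ih) => //.
    apply/measurable_EFinP; apply: (measurableT_comp (@normr_measurable R setT)).
    by apply: (measurableT_comp (fine_measurable _)).
  apply: filterS hfin => x hx Ox; rewrite /= normr_id.
  by rewrite -abse_EFin fineK// hx.
- apply: filterS2 hE hfin => x hx fx Ox.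
  by rewrite -abse_EFin fineK ?fx// -hx// gee0_abs.
Qed.

(** Constants are integrable because [Omega] has finite measure. The functions [C * (1 + s)] serve
    as dominating functions below. *)
Lemma integrable_quadratic (s : 'rV[R]_n -> R) (C : R) :
  dx.-integrable Omega (EFin \o s) ->
  dx.-integrable Omega (fun x => (C * (1 + s x))%:E).
Proof.
move=> si.
have i1 : dx.-integrable Omega (cst 1).
  apply/integrableP; split => //; rewrite (eq_integral (cst 1)).
    by rewrite integral_cst// mul1e.
  by move=> x _; rewrite /= normr1.
exact: (integrableZl mOmega C (integrableD mOmega i1 si)).
Qed.

(** Quadratic growth of [g] bounds the pairing a.e. by [C * (1 + s)] with [s] the second moment;
    this gives finiteness and integrability at once. *)
Lemma young_measure_representative (g : 'rV[R]_m -> R) (C : R) :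
  measurable_fun setT g -> (0 <= C)%R ->
  (forall z, `|g z| <= C * (1 + enorm z ^+ 2))%R ->
  exists2 p : 'rV[R]_n -> R, dx.-integrable Omega (EFin \o p) &
  {ae dx, forall x, Omega x -> osc_pairing y g x = (p x)%:E}.
Proof.
move=> mg C0 gC; have [nuL _ _ _] := yY.
have [h mh hE] := @Linfty_weak_measurable _ _ _ _ dx _ _ mOmega nuL g mg.
have {}hE : {ae dx, forall x, Omega x -> osc_pairing y g x = h x} by [].

have [s [s0 si sE]] := young_measure_moment.
have hs : {ae dx, forall x, Omega x ->
    `|h x| <= (C * (1 + s x))%:E /\ h x \is a fin_num}.
  apply: filterS2 hE sE => x hx sx Ox.
  have hC : `|h x| <= (C * (1 + s x))%:E.
    rewrite -hx// EFinM EFinD -sx//; exact: integral_le_quadratic.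
  by split => //; rewrite -abse_fin_num ge0_fin_numE// (le_lt_trans hC)// ltry.
exists (fine \o h).
- apply: (ae_le_integrable _ _ _ (integrable_quadratic C si)) => //.
    apply/measurable_EFinP.
    by apply: measurableT_comp => //; exact: fine_measurable.
  apply: filterS hs => x hx Ox; have [hC hfin] := hx Ox.
  rewrite [X in `|X|](fineK hfin); apply: le_trans hC _.
  by rewrite lee_fin ler_norm.
- by apply: filterS2 hE hs => x hx fx Ox; rewrite [LHS]hx// fineK// (fx Ox).2.
Qed.

(** The third clause records the extended real integrals of the coordinates: [barycenter] takes real
    values through [fine], which would hide infinite ones. *)
Lemma young_measure_barycenter : exists b : 'rV[R]_n -> 'rV[R]_m,
  [/\ measurable_fun Omega b,
   forall i, dx.-integrable Omega (fun x => ((b x) 0 i)%R%:E),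
   {ae dx, forall x, Omega x -> forall i,
     osc_pairing y (fun z => z 0 i)%R x = ((b x) 0 i)%R%:E} &
   {ae dx, forall x, Omega x -> barycenter y x = b x}].
Proof.
have mcoord i : measurable_fun setT (fun z : 'rV[R]_m => z 0 i)%R.
  by apply: continuous_measurable_rV; exact: continuous_coord.
have /choice[p pP] i : exists p : 'rV[R]_n -> R,
    dx.-integrable Omega (EFin \o p) /\
    {ae dx, forall x, Omega x -> osc_pairing y (fun z => z 0 i)%R x = (p x)%:E}.
  have [//||p ? ?] := @young_measure_representative (fun z => z 0 i)%R 1 (mcoord i).
    by move=> z; rewrite mul1r; exact: coord_bound.
  by exists p.
pose b x : 'rV[R]_m := \row_i p i x.
have bE : {ae dx, forall x, Omega x -> forall i,
     osc_pairing y (fun z => z 0 i)%R x = ((b x) 0 i)%R%:E}.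
  have : {ae dx, forall x i, Omega x ->
      osc_pairing y (fun z => z 0 i)%R x = (p i x)%:E}.
    by apply: filter_forall => i; exact: (pP i).2.
  by apply: filterS => x px Ox i; rewrite mxE px.
exists b; split => //.
- apply: measurable_fun_row => // i; apply/measurable_EFinP.
  exact: measurable_int (pP i).1.
- move=> i; rewrite (_ : (fun x => _) = EFin \o p i); first exact: (pP i).1.
  by apply/funext => x; rewrite mxE.
- apply: filterS bE => x bx Ox; apply/rowP => i; rewrite mxE.
  by have := bx Ox i; rewrite /osc_pairing /Rintegral => ->.
Qed.

Lemma young_measure_comp_barycenter (f : 'rV[R]_m -> R) (b : 'rV[R]_n -> 'rV[R]_m) :
  classF2 f -> measurable_fun Omega b ->
  {ae dx, forall x, Omega x -> forall i,
     osc_pairing y (fun z => z 0 i)%R x = ((b x) 0 i)%R%:E} ->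
  dx.-integrable Omega (EFin \o (f \o b)).
Proof.
move=> fF2 mb bE; have [C [C0 fC _]] := classF2_quadratic_bound fF2.
have [s [s0 si sE]] := young_measure_moment.
(* Jensen gives [(b x 0 i)^2 <= s x] for each coordinate; summing over the [m] coordinates yields
   [|b x|^2 <= m * s x], whence the factor [m]. *)
have msi : dx.-integrable Omega (EFin \o (fun x => m%:R * s x)%R).
  exact: (integrableZl mOmega m%:R si).
apply: (ae_le_integrable _ _ _ (integrable_quadratic C msi)) => //.
  apply/measurable_EFinP; apply: measurableT_comp => //.
  exact: (continuous_measurable_rV fF2.1).
apply: filterS2 bE sE => x bx sx Ox.
rewrite /= lee_fin [leRHS]ger0_norm; last by rewrite mulr_ge0// addr_ge0// mulr_ge0.
apply: le_trans (fC _) _; rewrite ler_wpM2l// lerD2l sqr_enorm.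
rewrite -[m in m%:R]card_ord mulr_natl -sumr_const; apply: ler_sum => i _.
apply: (@sqr_integral_le _ _ (osc y x) (fun z => z 0 i)%R).
- by apply: continuous_measurable_rV; exact: continuous_coord.
- by move=> z; exact: sqr_coord_le_enorm.
- exact: bx.
- exact: sx.
Qed.

(** On the sphere [0 <= f^infty <= C], the angle measures are probabilities on the sphere, and
    [conc y] is finite. *)
Lemma young_measure_conc_fin (f : 'rV[R]_m -> R) : classF2 f ->
  (forall z, 0 <= f z)%R ->
  \int[conc y]_(x in closure Omega) conc_pairing y (recession f) x \is a fin_num.
Proof.
move=> fF2 f0; have [C [C0 _ fC]] := classF2_quadratic_bound fF2.
have [_ _ [angle1 _] _] := yY.
have mS : measurable (unit_sphere m : set 'rV[R]_m).
  rewrite (_ : unit_sphere m = esq @^-1` [set 1%R]); last first.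
    apply/seteqP; split => z /=; rewrite /unit_sphere/= /esq.
      by move=> ->; rewrite expr1n.
    by move/eqP; rewrite sqrp_eq1 ?enorm_ge0// => /eqP.
  by rewrite -[X in measurable X]setTI; exact: mesq.
have pairing_bound x : closure Omega x ->
    0 <= conc_pairing y (recession f) x <= C%:E.
  move=> Ox; apply/andP; split.
    by apply: integral_ge0 => z Sz; rewrite lee_fin; have /andP[] := fC z Sz f0.
  apply: (@le_trans _ _ (\int[conc_angle y x]_(z in unit_sphere m) cst C%:E z)).
    apply: nonmeasurable_ge0_le_integral => z Sz;
      by rewrite lee_fin; have /andP[] := fC z Sz f0.
  rewrite integral_cst// [X in _ * X](_ : _ = 1) ?mule1//; exact: angle1.
have mcl : measurable (closure Omega).
  by apply: closed_measurable_rV; exact: closed_closure.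
rewrite ge0_fin_numE; last first.
  by apply: integral_ge0 => x /pairing_bound/andP[].
apply: (@le_lt_trans _ _ (\int[conc y]_(x in closure Omega) cst C%:E x)).
  by apply: nonmeasurable_ge0_le_integral => x /pairing_bound/andP[].
rewrite integral_cst// lte_mul_pinfty//.
by rewrite -ge0_fin_numE// fin_num_measure.
Qed.

End young_representatives.

(** * Splitting the variance, and barycenters of convex combinations *)

Section maximal_variance.
Context {R : realType} {n m : nat} (Omega : set 'rV[R]_n).
Hypotheses (mOmega : measurable Omega).
Hypotheses (Omega_fin : (lebesgue_measure_rV n Omega < +oo)%E).
Local Open Scope ereal_scope.
Local Notation dx := (@lebesgue_measure_rV R n).
Implicit Types y : @young_triple R n m.

(** All three terms are finite, so the variance becomes the real number [A - B + c] and maximality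
    can be handled by linear arithmetic. *)
Lemma young_variance_split (f : 'rV[R]_m -> R) y : classF2 f ->
  (forall z, 0 <= f z)%R -> young_measure Omega y ->
  exists (b : 'rV[R]_n -> 'rV[R]_m) (A B c : R),
  [/\ forall i, dx.-integrable Omega (fun x => (b x 0 i)%R%:E),
      {ae dx, forall x, Omega x -> forall i,
        osc_pairing y (fun z => z 0 i)%R x = (b x 0 i)%R%:E},
      {ae dx, forall x, Omega x -> barycenter y x = b x} &
   [/\ dx.-integrable Omega (EFin \o (f \o b)),
      \int[dx]_(x in Omega) osc_pairing y f x = A%:E,
      \int[dx]_(x in Omega) (f (b x))%:E = B%:E,
      \int[conc y]_(x in closure Omega) conc_pairing y (recession f) x = c%:E &
      young_variance Omega f y = (A - B + c)%:E]].
Proof.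
move=> fF2 f0 yY.
have [C [C0 fC _]] := classF2_quadratic_bound fF2.
have mf := continuous_measurable_rV fF2.1.
have [b [mb ib bE baryE]] := young_measure_barycenter mOmega Omega_fin yY.
have ifb := young_measure_comp_barycenter mOmega Omega_fin yY fF2 mb bE.
have [a ia aE] := young_measure_representative mOmega Omega_fin yY mf C0 fC.
have finA : \int[dx]_(x in Omega) (a x)%:E \is a fin_num.
  exact: integrable_fin_num.
have finB : \int[dx]_(x in Omega) (f (b x))%:E \is a fin_num.
  exact: integrable_fin_num.
have finc := young_measure_conc_fin yY fF2 f0.
exists b, (fine (\int[dx]_(x in Omega) (a x)%:E)),
  (fine (\int[dx]_(x in Omega) (f (b x))%:E)),
  (fine (\int[conc y]_(x in closure Omega) conc_pairing y (recession f) x)).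
split => //; rewrite EFinD EFinB !fineK//; split => //.
  by apply: ae_eq_nonmeasurable_integral => //; exact: measurable_int ia.
rewrite /young_variance; congr (_ + _).
rewrite -(integralB mOmega ia ifb); apply: ae_eq_nonmeasurable_integral => //.
  exact: emeasurable_funB (measurable_int _ ia) (measurable_int _ ifb).
by apply: filterS2 aE baryE => x ax bx Ox; rewrite ax// bx.
Qed.

(** The recession function of a coordinate vanishes, so the concentration term drops out. *)
Lemma young_pairing_coord y (b : 'rV[R]_n -> 'rV[R]_m) i (E : set 'rV[R]_n) :
  dx.-integrable Omega (fun x => (b x 0 i)%R%:E) ->
  {ae dx, forall x, Omega x -> forall i,
    osc_pairing y (fun z => z 0 i)%R x = (b x 0 i)%R%:E} ->
  measurable E -> E `<=` Omega ->
  young_pairing Omega y (fun z => z 0 i)%R E = \int[dx]_(x in E) (b x 0 i)%R%:E.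
Proof.
move=> ib bE mE EO; rewrite /young_pairing setIidr//.
rewrite [X in _ + X]integral0_eq ?adde0; last first.
  by move=> x _; apply: integral0_eq => z _; rewrite recession_coord.
apply: ae_eq_nonmeasurable_integral => //.
  exact: measurable_funS (measurable_int _ ib).
by apply: filterS bE => x bx Ex; apply: bx; exact: EO.
Qed.

(** Testing the defining identity with the coordinates on every measurable subset of [Omega] gives
    equal integrals there, hence equality a.e. of the densities. *)
Lemma convex_combination_barycenter (t : R) y1 y2 y
    (b1 b2 b : 'rV[R]_n -> 'rV[R]_m) :
  is_convex_combination Omega t y1 y2 y ->
  (forall i, dx.-integrable Omega (fun x => (b1 x 0 i)%R%:E)) ->
  (forall i, dx.-integrable Omega (fun x => (b2 x 0 i)%R%:E)) ->
  (forall i, dx.-integrable Omega (fun x => (b x 0 i)%R%:E)) ->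
  {ae dx, forall x, Omega x -> forall i,
    osc_pairing y1 (fun z => z 0 i)%R x = (b1 x 0 i)%R%:E} ->
  {ae dx, forall x, Omega x -> forall i,
    osc_pairing y2 (fun z => z 0 i)%R x = (b2 x 0 i)%R%:E} ->
  {ae dx, forall x, Omega x -> forall i,
    osc_pairing y (fun z => z 0 i)%R x = (b x 0 i)%R%:E} ->
  {ae dx, forall x, Omega x -> b x = t *: b1 x + (1 - t) *: b2 x}%R.
Proof.
move=> ycc i1 i2 ib E1 E2 E.
have : {ae dx, forall x i, Omega x ->
    (b x 0 i)%R%:E = (t * b1 x 0 i + (1 - t) * b2 x 0 i)%R%:E}.
  apply: filter_forall => i.
  have ti1 := integrableZl mOmega t (i1 i).
  have ti2 := integrableZl mOmega (1 - t)%R (i2 i).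
  apply: (integral_ae_eq mOmega (ib i)).
    exact: measurable_int (integrableD mOmega ti1 ti2).
  move=> U UO mU.
  have iU (p : 'rV[R]_n -> \bar R) : dx.-integrable Omega p -> dx.-integrable U p.
    exact: integrableS.
  rewrite -(young_pairing_coord (ib i) E)// ycc//; last 2 first.
  - exact: classF2_coord.
  - exact: subset_trans UO (@subset_closure _ _).
  rewrite (young_pairing_coord (i1 i) E1)// (young_pairing_coord (i2 i) E2)//.
  rewrite -(integralZl mU (iU _ (i1 i))) -(integralZl mU (iU _ (i2 i))).
  by rewrite -(integralD mU (iU _ ti1) (iU _ ti2)).
apply: filterS => x bx Ox; apply/rowP => i; rewrite !mxE.
by have [] := bx i Ox.
Qed.

End maximal_variance.

(** * Maximality at the midpoint and strict convexity *)

Unset Implicit Arguments.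

Theorem theorem2p12 (R : realType) (n m : nat) (Omega : set 'rV[R]_n)
    (Omega_open : open Omega) (Omega_bounded : bounded_set Omega)
    (f : 'rV[R]_m -> R) (f_F2 : classF2 f) (f_ge0 : forall z, 0 <= f z)
    (f_sconvex : strictly_convex f)
    (M : set (young_triple n m)) (M_convex : convex_set_of_young_measures Omega M)
    (y1 y2 : young_triple n m)
    (y1_max : maximal_in M (young_variance Omega f) y1)
    (y2_max : maximal_in M (young_variance Omega f) y2) :
  {ae @lebesgue_measure_rV R n,
     forall x, Omega x -> barycenter y1 x = barycenter y2 x} /\
  (\int[@lebesgue_measure_rV R n]_(x in Omega) osc_pairing y1 f x +
   \int[conc y1]_(x in closure Omega) conc_pairing y1 (recession f) x =
   \int[@lebesgue_measure_rV R n]_(x in Omega) osc_pairing y2 f x +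
   \int[conc y2]_(x in closure Omega) conc_pairing y2 (recession f) x)%E.
Proof.
have mOmega := open_measurable_rV Omega_open.
have Omega_fin := bounded_lebesgue_measure_rV mOmega Omega_bounded.
have [MY Mcc] := M_convex; have [My1 max1] := y1_max; have [My2 max2] := y2_max.
pose t : R := 2^-1.
have t01 : 0 <= t <= 1 by rewrite /t; apply/andP; split; lra.
have [y My ycc] := Mcc t y1 y2 t01 My1 My2.
have [b1 [A1 [B1 [c1 [i1 E1 bary1 [ifb1 A1E B1E c1E V1]]]]]] :=
  young_variance_split mOmega Omega_fin f_F2 f_ge0 (MY _ My1).
have [b2 [A2 [B2 [c2 [i2 E2 bary2 [ifb2 A2E B2E c2E V2]]]]]] :=
  young_variance_split mOmega Omega_fin f_F2 f_ge0 (MY _ My2).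
have [b [A [B [c [ib E _ [ifb AE BE cE V]]]]]] :=
  young_variance_split mOmega Omega_fin f_F2 f_ge0 (MY _ My).
have bmid := convex_combination_barycenter mOmega ycc i1 i2 ib E1 E2 E.
have mcl : measurable (closure Omega).
  by apply: closed_measurable_rV; exact: closed_closure.
(* Here the integrand [f] itself is the test function, on the whole closure of [Omega]. *)
have energy : A + c = t * (A1 + c1) + (1 - t) * (A2 + c2).
  have := ycc f f_F2 _ mcl (@subset_refl _ _).
  rewrite /young_pairing setIid setIidl; last exact: subset_closure.
  by rewrite A1E A2E AE c1E c2E cE -!EFinD => -[].
have V12 : A1 - B1 + c1 = A2 - B2 + c2.
  apply/eqP; rewrite eq_le -!lee_fin -V1 -V2.
  by rewrite max1// max2.
have Vy : A - B + c <= A1 - B1 + c1 by rewrite -lee_fin -V1 -V max1.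
(* [V1] and [V2] have the same value, so their mean also bounds the variance of [y]; the energies
   cancel by affinity. *)
have Bmid : t * B1 + (1 - t) * B2 <= B by move: energy; rewrite /t; lra.
(* [gap] is the convexity defect of [f] between the barycenters; [Bmid] makes its integral
   non-positive, while convexity makes it non-negative a.e. *)
pose gap x := t * f (b1 x) + (1 - t) * f (b2 x) - f (b x).
have ti1 := integrableZl mOmega t ifb1.
have ti2 := integrableZl mOmega (1 - t) ifb2.
have i12 := integrableD mOmega ti1 ti2.
have igap : (@lebesgue_measure_rV R n).-integrable Omega (EFin \o gap).
  exact: (integrableB mOmega i12 ifb).
have gapE : (\int[@lebesgue_measure_rV R n]_(x in Omega) (gap x)%:E =
    (t * B1 + (1 - t) * B2 - B)%:E)%E.
  transitivity (\int[@lebesgue_measure_rV R n]_(x in Omega)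
      ((t%:E * (f (b1 x))%:E + (1 - t)%:E * (f (b2 x))%:E) - (f (b x))%:E))%E => //.
  rewrite (integralB mOmega i12 ifb) (integralD mOmega ti1 ti2).
  by rewrite (integralZl mOmega ifb1) (integralZl mOmega ifb2) B1E B2E BE.
have gapP x : b x = t *: b1 x + (1 - t) *: b2 x ->
    0 <= gap x /\ (gap x = 0 -> b1 x = b2 x).
  rewrite /gap => ->; have [->|neq] := eqVneq (b1 x) (b2 x).
    by rewrite -!scalerDl !(addrC t) subrK !scale1r subrr.
  have /(f_sconvex _ _ t neq) : 0 < t by rewrite /t; lra.
  have t1 : t < 1 by rewrite /t; lra.
  move=> /(_ t1); rewrite -subr_gt0 => gap_gt0; split => [|gap_eq0].
    exact: ltW.
  by move: gap_gt0; rewrite gap_eq0 ltxx.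
have gap0 : ae_eq (@lebesgue_measure_rV R n) Omega (EFin \o gap) (cst 0%E).
  apply/ae_eq_integral_abs => //; first exact: measurable_int igap.
  apply/eqP; rewrite eq_le integral_ge0 ?andbT; last by move=> x _; exact: abse_ge0.
  (* Since [gap] is non-negative a.e., the integral of its absolute value is that of [gap], which is
     at most 0 by [Bmid]. *)
  rewrite (_ : integral _ _ _ = (t * B1 + (1 - t) * B2 - B)%:E).
    by rewrite lee_fin; lra.
  rewrite -gapE; apply: ae_eq_nonmeasurable_integral => //.
    exact: measurable_int igap.
  apply: filterS bmid => x bx Ox; have [g0 _] := gapP x (bx Ox).
  by rewrite /= ger0_norm.
have b12 : {ae @lebesgue_measure_rV R n, forall x, Omega x -> b1 x = b2 x}.
  apply: filterS2 bmid gap0 => x bx gx Ox.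
  by have [_] := gapP x (bx Ox); apply; have [] := gx Ox.
split.
  apply: filterS3 bary1 bary2 b12 => x h1 h2 h Ox.
  by rewrite h1// h2// h.
have B12 : B1 = B2.
  suff [] : B1%:E = B2%:E by [].
  rewrite -B1E -B2E; apply: ae_eq_nonmeasurable_integral => //.
    exact: measurable_int ifb2.
  by apply: filterS b12 => x h Ox; rewrite h.
(* With [B1 = B2], the equality [V12] of the variances reduces to [A1 + c1 = A2 + c2]. *)
by rewrite A1E A2E c1E c2E -!EFinD; congr EFin; lra.
Qed.
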